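(* Let $C_4\approx1.053322135$ be the positive root of $6137x^5+5335x^4+678x^3-3702x^2-9479x-1225$ and let $C_5\approx1.194505073$ be the positive root of $x^4+2x^3+22x^2-30x-1$. For every triangle, the following bounds hold, where a bound $L\le \frac{D(n,i)}{D(n,j)}\le U$ means $L\,D(n,j)\le D(n,i)\le U\,D(n,j)$ (and similarly for one-sided bounds and equalities): $$\frac{D(5,1)}{D(5,2)}\le3,\quad \frac{D(5,1)}{D(5,3)}\le1,\quad \frac{D(5,1)}{D(5,4)}\le1,\quad \frac{D(5,1)}{D(5,8)}\le1,\quad \frac{D(5,1)}{D(5,9)}\le1,\quad \frac{D(5,1)}{D(5,10)}\le1,$$ $$\frac{D(5,2)}{D(5,3)}=\frac13,\quad \frac{D(5,2)}{D(5,4)}=\frac13,\quad \frac13\le\frac{D(5,2)}{D(5,6)},\quad \frac13\le\frac{D(5,2)}{D(5,7)},\quad \frac19\le\frac{D(5,2)}{D(5,8)}\le1,\quad \frac13\le\frac{D(5,2)}{D(5,9)}\le1,\quad \frac13\le\frac{D(5,2)}{D(5,10)}\le1,$$ $$\frac{D(5,3)}{D(5,4)}=1,\quad 1\le\frac{D(5,3)}{D(5,6)},\quad 1\le\frac{D(5,3)}{D(5,7)},\quad \frac13\le\frac{D(5,3)}{D(5,8)}\le3,\quad 1\le\frac{D(5,3)}{D(5,9)}\le3,\quad 1\le\frac{D(5,3)}{D(5,10)}\le3,$$ $$1\le\frac{D(5,4)}{D(5,6)},\quad 1\le\frac{D(5,4)}{D(5,7)},\quad \frac13\le\frac{D(5,4)}{D(5,8)}\le3,\quad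 1\le\frac{D(5,4)}{D(5,9)}\le3,\quad 1\le\frac{D(5,4)}{D(5,10)}\le3,$$ $$\frac{D(5,6)}{D(5,8)}\le1,\quad \frac{D(5,6)}{D(5,9)}\le C_4,\quad \frac{D(5,6)}{D(5,10)}\le C_5,\quad \frac{D(5,7)}{D(5,8)}\le1,\quad \frac{D(5,7)}{D(5,9)}\le1,\quad \frac{D(5,7)}{D(5,10)}\le1,$$ $$1\le\frac{D(5,8)}{D(5,9)}\le3,\quad 1\le\frac{D(5,8)}{D(5,10)}\le3,\quad 1\le\frac{D(5,9)}{D(5,10)}\le7-4\sqrt2.$$
   Context: For a (nondegenerate) triangle $ABC$ with side lengths $a=BC$, $b=CA$, $c=AB$, a point with barycentric coordinates $(u:v:w)$ is $(uA+vB+wC)/(u+v+w)$. For $1\le n\le 10$ the triangle center $X_n$ is the point with barycentric coordinates $(f_n(a,b,c):f_n(b,c,a):f_n(c,a,b))$, where $f_1=a$ (incenter); $f_2=1$ (centroid); $f_3=a^2(a^2-b^2-c^2)$ (circumcenter); $f_4=(a^2+b^2-c^2)(a^2-b^2+c^2)$ (orthocenter); $f_5=c^4-a^2b^2+b^4-a^2c^2-2b^2c^2$ (nine-point center); $f_6=a^2$ (symmedian point); $f_7=(a+b-c)(a-b+c)$ (Gergonne point); $f_8=a-b-c$ (Nagel point); $f_9=a(a-b-c)$ (mittenpunkt); $f_{10}=b+c$ (Spieker center). $D(i,j)$ denotes the Euclidean distance between $X_i$ and $X_j$. *)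

(* Defs.v *)
From Stdlib Require Import Reals Lra.
Open Scope R_scope.

Definition point : Type := (R * R)%type.

Definition edist (P Q : point) : R := dist_euc (fst P) (snd P) (fst Q) (snd Q).

(* The vectors AB and AC are linearly independent, i.e. A, B, C do not lie on
   a line. *)
Definition nondegenerate (A B C : point) : Prop :=
  (fst B - fst A) * (snd C - snd A) - (fst C - fst A) * (snd B - snd A) <> 0.

(* Meaningful only when u + v + w <> 0, which holds for every use below when
   A, B, C form a triangle. *)
Definition barycentric (A B C : point) (u v w : R) : point :=
  ((u * fst A + v * fst B + w * fst C) / (u + v + w),
   (u * snd A + v * snd B + w * snd C) / (u + v + w)).

(* The value outside 1 <= n <= 10 is a dummy. *)
Definition center_function (n : nat) (a b c : R) : R :=
  match n with
  | 1%nat  => a                                            (* incenter *)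
  | 2%nat  => 1                                            (* centroid *)
  | 3%nat  => a ^ 2 * (a ^ 2 - b ^ 2 - c ^ 2)              (* circumcenter *)
  | 4%nat  => (a ^ 2 + b ^ 2 - c ^ 2) * (a ^ 2 - b ^ 2 + c ^ 2)
                                                           (* orthocenter *)
  | 5%nat  => c ^ 4 - a ^ 2 * b ^ 2 + b ^ 4 - a ^ 2 * c ^ 2
              - 2 * b ^ 2 * c ^ 2                          (* nine-point center *)
  | 6%nat  => a ^ 2                                        (* symmedian point *)
  | 7%nat  => (a + b - c) * (a - b + c)                    (* Gergonne point *)
  | 8%nat  => a - b - c                                    (* Nagel point *)
  | 9%nat  => a * (a - b - c)                              (* mittenpunkt *)
  | 10%nat => b + c                                        (* Spieker center *)
  | _ => 0
  end.

Definition center (A B C : point) (n : nat) : point :=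
  let a := edist B C in
  let b := edist C A in
  let c := edist A B in
  barycentric A B C (center_function n a b c)
                    (center_function n b c a)
                    (center_function n c a b).

Definition center_dist (A B C : point) (i j : nat) : R :=
  edist (center A B C i) (center A B C j).

Definition poly4 (x : R) : R :=
  6137 * x ^ 5 + 5335 * x ^ 4 + 678 * x ^ 3 - 3702 * x ^ 2 - 9479 * x - 1225.

Definition poly5 (x : R) : R :=
  x ^ 4 + 2 * x ^ 3 + 22 * x ^ 2 - 30 * x - 1.

Definition positive_root (p : R -> R) (x : R) : Prop := 0 < x /\ p x = 0.

(* Each polynomial has exactly one positive root, so "the" positive root is
   well defined; the numerical values are confirmed as well. *)

Lemma poly4_root_unique (x y : R) :
  positive_root poly4 x -> positive_root poly4 y -> x = y.
Proof.
intros [x0 px] [y0 py].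
assert (E : (x - y) *
  (6137 * (x ^ 3 * y ^ 3 * (x + y)) + 5335 * (x ^ 3 * y ^ 3)
   + 3702 * (x ^ 2 * y ^ 2) + 9479 * (x * y * (x + y))
   + 1225 * (x ^ 2 + x * y + y ^ 2)) = y ^ 3 * poly4 x - x ^ 3 * poly4 y)
  by (unfold poly4; ring).
rewrite px, py, !Rmult_0_r, Rminus_0_r in E.
destruct (Rmult_integral _ _ E) as [E1 | E1]; [lra |].
assert (0 < x * y) by (apply Rmult_lt_0_compat; lra).
assert (0 < x ^ 2) by (apply pow_lt; lra).
assert (0 < y ^ 2) by (apply pow_lt; lra).
assert (0 < x ^ 3 * y ^ 3) by (apply Rmult_lt_0_compat; apply pow_lt; lra).
assert (0 < x ^ 2 * y ^ 2) by (apply Rmult_lt_0_compat; lra).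
assert (0 < x ^ 3 * y ^ 3 * (x + y)) by (apply Rmult_lt_0_compat; lra).
assert (0 < x * y * (x + y)) by (apply Rmult_lt_0_compat; lra).
lra.
Qed.

Lemma poly5_root_unique (x y : R) :
  positive_root poly5 x -> positive_root poly5 y -> x = y.
Proof.
intros [x0 px] [y0 py].
assert (E : (x - y) *
  (x * y * (x ^ 2 + x * y + y ^ 2) + 2 * (x * y * (x + y)) + 22 * (x * y) + 1)
  = y * poly5 x - x * poly5 y) by (unfold poly5; ring).
rewrite px, py, !Rmult_0_r, Rminus_0_r in E.
destruct (Rmult_integral _ _ E) as [E1 | E1]; [lra |].
assert (0 < x * y) by (apply Rmult_lt_0_compat; lra).
assert (0 < x ^ 2) by (apply pow_lt; lra).
assert (0 < y ^ 2) by (apply pow_lt; lra).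
assert (0 < x * y * (x ^ 2 + x * y + y ^ 2))
  by (apply Rmult_lt_0_compat; lra).
assert (0 < x * y * (x + y)) by (apply Rmult_lt_0_compat; lra).
lra.
Qed.

Lemma poly4_root_exists : exists x : R,
  positive_root poly4 x /\ 1.0533221345 <= x <= 1.0533221355.
Proof.
destruct (IVT poly4 1.0533221345 1.0533221355) as [x [xb px]].
- unfold poly4; reg.
- lra.
- unfold poly4; lra.
- unfold poly4; lra.
- exists x; split; [split |]; [lra | exact px | exact xb].
Qed.

Lemma poly5_root_exists : exists x : R,
  positive_root poly5 x /\ 1.1945050725 <= x <= 1.1945050735.
Proof.
destruct (IVT poly5 1.1945050725 1.1945050735) as [x [xb px]].
- unfold poly5; reg.
- lra.
- unfold poly5; lra.
- unfold poly5; lra.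
- exists x; split; [split |]; [lra | exact px | exact xb].
Qed.

(* Main.v *)
(* Let r be the inradius and s the semiperimeter, in units of the circumradius,
   and S = s^2. The squared distances from the nine-point center are rational
   functions of r and S, listed in unit_dist_sqr. With t = sqrt (1 - 2 r),
   Blundon's inequality confines S to the interval
     (1 - t) (3 + t)^3 / 4 <= S <= (1 + t) (3 - t)^3 / 4
   whose ends are the isosceles triangles. Each squared distance is monotone in
   S, and at both ends it is the square of a rational function of t, so every
   claim becomes an inequality in the single variable t in [0, 1). *)

Require Import Defs.
From Stdlib Require Import Reals Lra Lia Psatz.
From Coquelicot Require Import Rcomplements.
Open Scope R_scope.

Ltac pos :=
  repeat (assumption || lra || apply Rmult_lt_0_compat
          || apply Rplus_lt_0_compat || apply pow_lt).

(** * Distances from the nine-point center in barycentric coordinates *)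

Lemma edist_nonneg (P Q : point) : 0 <= edist P Q.
Proof. apply sqrt_pos. Qed.

Lemma edist_sqr (P Q : point) :
  edist P Q ^ 2 = (fst P - fst Q) ^ 2 + (snd P - snd Q) ^ 2.
Proof.
unfold edist, dist_euc.
rewrite pow2_sqrt; [unfold Rsqr; ring |].
apply Rplus_le_le_0_compat; apply Rle_0_sqr.
Qed.

(* Heron: sixteen times the squared area. *)
Definition area16 (a b c : R) : R :=
  (a + b + c) * (b + c - a) * (c + a - b) * (a + b - c).

(* Squared distance from the nine-point center to P = (u : v : w). With the
   circumcenter as origin the nine-point center is H / 2 with H = A + B + C,
   and the terms come from |P|^2 - P.H + |H|^2 / 4. *)
Definition nine_point_sqr (a b c u v w : R) : R :=
  ((a * b * c) ^ 2 / area16 a b c + a ^ 2 + b ^ 2 + c ^ 2) / 4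
  - (a ^ 2 * (v * w) + b ^ 2 * (w * u) + c ^ 2 * (u * v)) / (u + v + w) ^ 2
  - (a ^ 2 * u + b ^ 2 * v + c ^ 2 * w) / (2 * (u + v + w)).

Lemma area16_cross (A B C : point) :
  area16 (edist B C) (edist C A) (edist A B) =
  4 * ((fst B - fst A) * (snd C - snd A)
       - (fst C - fst A) * (snd B - snd A)) ^ 2.
Proof.
set (a := edist B C); set (b := edist C A); set (c := edist A B).
replace (area16 a b c) with
  (2 * (a ^ 2 * b ^ 2 + b ^ 2 * c ^ 2 + c ^ 2 * a ^ 2)
   - (a ^ 2 * a ^ 2 + b ^ 2 * b ^ 2 + c ^ 2 * c ^ 2))
  by (unfold area16; ring).
unfold a, b, c; rewrite !edist_sqr; ring.
Qed.

Lemma area16_pos (A B C : point) :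
  nondegenerate A B C ->
  0 < area16 (edist B C) (edist C A) (edist A B).
Proof.
intros h; rewrite area16_cross.
apply Rmult_lt_0_compat; [lra |]; rewrite <- Rsqr_pow2.
now apply Rlt_0_sqr.
Qed.

Lemma center_dist5_sqr (A B C : point) (n : nat) :
  nondegenerate A B C ->
  let a := edist B C in let b := edist C A in let c := edist A B in
  let u := center_function n a b c in
  let v := center_function n b c a in
  let w := center_function n c a b in
  u + v + w <> 0 ->
  center_dist A B C 5 n ^ 2 = nine_point_sqr a b c u v w.
Proof.
intros h a b c u v w hs.
pose proof (area16_cross A B C) as hS; fold a b c in hS.
(* Written in squares of the sides only, so that [edist_sqr] removes every square root. *)
assert (h5 : forall x y z, center_function 5 x y z =
  z ^ 2 * z ^ 2 - x ^ 2 * y ^ 2 + y ^ 2 * y ^ 2 - x ^ 2 * z ^ 2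
  - 2 * y ^ 2 * z ^ 2) by (intros; simpl; ring).
unfold nine_point_sqr; rewrite hS.
replace ((a * b * c) ^ 2) with (a ^ 2 * b ^ 2 * c ^ 2) by ring.
unfold center_dist; rewrite edist_sqr; unfold center; fold a b c.
fold u v w; rewrite !h5; clearbody u v w; clear hS h5.
unfold a, b, c; rewrite !edist_sqr; clear a b c.
destruct A as [a1 a2], B as [b1 b2], C as [c1 c2].
unfold nondegenerate in h; unfold barycentric; cbn [fst snd] in *.
(* In coordinates relative to [A], [h] says that the determinant of the two edge vectors is
   nonzero. *)
remember (b1 - a1) as p1 eqn:e1; remember (b2 - a2) as p2 eqn:e2.
remember (c1 - a1) as q1 eqn:e3; remember (c2 - a2) as q2 eqn:e4.
replace b1 with (a1 + p1) by lra; replace b2 with (a2 + p2) by lra.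
replace c1 with (a1 + q1) by lra; replace c2 with (a2 + q2) by lra.
clear e1 e2 e3 e4.
field.
repeat split; try assumption.
intros e; apply h; nra.
Qed.

(** * Ravi substitution and passage to [r] and [S] *)

Lemma pos_of_mul_pos (x y z : R) :
  0 <= x + y -> 0 <= x + z -> 0 < x * y * z -> 0 < x.
Proof.
intros hxy hxz h; destruct (Rle_lt_dec x 0) as [l |]; [| assumption].
assert (0 <= y * z) by (apply Rmult_le_pos; lra).
nra.
Qed.

(** Heron's product is positive, and any two of [b + c - a], [c + a - b], [a + b - c] add up to
    twice a side. One nonpositive factor would leave two nonnegative ones, hence a nonpositive
    product. *)
Lemma triangle_ravi (A B C : point) :
  nondegenerate A B C ->
  exists x y z, 0 < x /\ 0 < y /\ 0 < z /\
    edist B C = y + z /\ edist C A = z + x /\ edist A B = x + y.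
Proof.
intros h; pose proof (area16_pos A B C h) as hS; revert hS.
generalize (edist_nonneg B C) (edist_nonneg C A) (edist_nonneg A B).
generalize (edist B C) (edist C A) (edist A B); intros a b c ha hb hc.
unfold area16; intros hS.
set (x := b + c - a) in *; set (y := c + a - b) in *.
set (z := a + b - c) in *.
assert (hs : 0 < a + b + c).
{ destruct (Rle_lt_dec (a + b + c) 0) as [l |]; [| assumption].
  replace (a + b + c) with 0 in hS by lra; lra. }
assert (hxyz : 0 < x * y * z).
{ apply (Rmult_lt_reg_l (a + b + c)); [assumption |].
  rewrite Rmult_0_r; lra. }
assert (hx : 0 < x)
  by (apply (pos_of_mul_pos x y z); [unfold x, y | unfold x, z |]; lra).
assert (hy : 0 < y)
  by (apply (pos_of_mul_pos y z x); [unfold y, z | unfold y, x |]; lra).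
assert (hz : 0 < z)
  by (apply (pos_of_mul_pos z x y); [unfold z, x | unfold z, y |]; lra).
exists (x / 2), (y / 2), (z / 2); unfold x, y, z in *; repeat split; lra.
Qed.

(* The sides are y + z, z + x, x + y; the ratios are to the circumradius. *)
Definition inradius_ratio (x y z : R) : R :=
  4 * (x * y * z) / ((x + y) * (y + z) * (z + x)).

Definition semiperimeter_ratio_sqr (x y z : R) : R :=
  16 * ((x + y + z) ^ 3 * (x * y * z)) / ((x + y) * (y + z) * (z + x)) ^ 2.

Definition circumradius_sqr (x y z : R) : R :=
  ((x + y) * (y + z) * (z + x)) ^ 2 / (16 * ((x + y + z) * (x * y * z))).

(* Squared distance from the nine-point center to X_n when the circumradius
   is 1, the inradius r and the squared semiperimeter S. *)
Definition unit_dist_sqr (n : nat) (r S : R) : R :=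
  match n with
  | 1%nat => (1 - 2 * r) ^ 2 / 4
  | 2%nat => (9 - 2 * S + 2 * r * (r + 4)) / 36
  | 3%nat | 4%nat => (9 - 2 * S + 2 * r * (r + 4)) / 4
  | 6%nat => 1 / 4 - 12 * r ^ 2 * S / (S - r * (r + 4)) ^ 2
             + 2 * r ^ 2 * S / (S - r * (r + 4))
  | 7%nat => 1 / 4 - r * (r + 4) / 2
             + 3 * r * (4 - r) * S / (2 * (r + 4) ^ 2)
  | 8%nat => (1 - 2 * r) ^ 2 / 2 + 2 * (1 - 2 * r)
             - (9 - 2 * S + 2 * r * (r + 4)) / 4
  | 9%nat => 1 / 4 - r * (r + 1) * S / (r + 4) ^ 2
  | 10%nat => (1 - 2 * r) / 4
  | _ => 0
  end.

Lemma weight_sum_neq0 (x y z : R) (n : nat) :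
  0 < x -> 0 < y -> 0 < z -> (1 <= n <= 10)%nat ->
  center_function n (y + z) (z + x) (x + y)
  + center_function n (z + x) (x + y) (y + z)
  + center_function n (x + y) (y + z) (z + x) <> 0.
Proof.
intros hx hy hz hn.
(* Each weight sum is a nonzero constant or a nonzero multiple of one of these four quantities. *)
assert (hs : 0 < x + y + z) by lra.
assert (hp : 0 < (x + y + z) * (x * y * z)) by pos.
assert (hq : 0 < x * y + y * z + z * x) by pos.
assert (hQ : 0 < (y + z) ^ 2 + (z + x) ^ 2 + (x + y) ^ 2) by pos.
destruct n as [| [| [| [| [| [| [| [| [| [| [| n]]]]]]]]]]];
  try lia; cbn [center_function]; lra.
Qed.

Lemma nine_point_sqr_ravi (x y z : R) (n : nat) :
  0 < x -> 0 < y -> 0 < z -> (1 <= n <= 10)%nat ->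
  nine_point_sqr (y + z) (z + x) (x + y)
    (center_function n (y + z) (z + x) (x + y))
    (center_function n (z + x) (x + y) (y + z))
    (center_function n (x + y) (y + z) (z + x)) =
  circumradius_sqr x y z *
  unit_dist_sqr n (inradius_ratio x y z) (semiperimeter_ratio_sqr x y z).
Proof.
intros hx hy hz hn.
pose proof (weight_sum_neq0 x y z n hx hy hz hn) as hs.
(* The numerator of [S - r (r + 4)], which is a denominator if [n = 6]. *)
assert (hd : 16 * ((x + y + z) ^ 3 * (x * y * z)) - 4 * (x * y * z)
  * (4 * (x * y * z) + 4 * ((x + y) * (y + z) * (z + x))) <> 0).
{ replace (_ - _) with (8 * ((x + y + z) * (x * y * z))
    * ((y + z) ^ 2 + (z + x) ^ 2 + (x + y) ^ 2)) by ring.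
  apply Rgt_not_eq; unfold Rgt; pos. }
unfold nine_point_sqr, area16, circumradius_sqr, inradius_ratio,
  semiperimeter_ratio_sqr.
destruct n as [| [| [| [| [| [| [| [| [| [| [| n]]]]]]]]]]];
  try lia; cbn [center_function unit_dist_sqr] in *; field;
  repeat split; first [exact hs | exact hd
    | apply Rgt_not_eq; unfold Rgt; solve [pos]
    | intros e; apply hs; rewrite <- e; ring].
Qed.

(** * Blundon's interval *)

Lemma triangle_shape (A B C : point) :
  nondegenerate A B C ->
  exists rho t S : R,
    0 < rho /\ 0 <= t < 1 /\
    (1 - t) * (3 + t) ^ 3 <= 4 * S <= (1 + t) * (3 - t) ^ 3 /\
    forall n, (1 <= n <= 10)%nat ->
      center_dist A B C 5 n ^ 2 =
      rho ^ 2 * unit_dist_sqr n ((1 - t ^ 2) / 2) S.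
Proof.
intros h.
destruct (triangle_ravi A B C h) as (x & y & z & hx & hy & hz & ea & eb & ec).
set (r := inradius_ratio x y z).
set (S := semiperimeter_ratio_sqr x y z).
assert (hP : 0 < (x + y) * (y + z) * (z + x)) by pos.
assert (hR : 0 < circumradius_sqr x y z).
{ unfold circumradius_sqr; apply Rdiv_lt_0_compat; pos. }
assert (hr : 0 < r).
{ unfold r, inradius_ratio; apply Rdiv_lt_0_compat; pos. }
(* Euler's inequality, as a weighted sum of squares; it makes [t] a real square root. *)
assert (euler : 0 <= 1 - 2 * r).
{ replace (1 - 2 * r) with ((x * (y - z) ^ 2 + y * (z - x) ^ 2
    + z * (x - y) ^ 2) / ((x + y) * (y + z) * (z + x))).
  - apply Rdiv_le_0_compat; [| assumption].
    repeat apply Rplus_le_le_0_compat; apply Rmult_le_pos;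
      try apply pow2_ge_0; lra.
  - unfold r, inradius_ratio; field; repeat split; lra. }
set (t := sqrt (1 - 2 * r)).
assert (ht : t ^ 2 = 1 - 2 * r) by now apply pow2_sqrt.
assert (t0 : 0 <= t) by apply sqrt_pos.
assert (t1 : t < 1) by nra.
assert (er : (1 - t ^ 2) / 2 = r) by lra.
(* Blundon's inequality: the discriminant of the cubic with roots x, y, z. *)
assert (blundon : (S - 2 - 10 * r + r ^ 2) ^ 2 <= (2 * t ^ 3) ^ 2).
{ replace ((2 * t ^ 3) ^ 2) with (4 * (t ^ 2) ^ 3) by ring; rewrite ht.
  apply Rminus_le_0.
  replace (_ - _) with (64 * ((x + y + z) ^ 3 * (x * y * z))
    * ((x - y) * (y - z) * (z - x)) ^ 2
    / ((x + y) * (y + z) * (z + x)) ^ 4).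
  - apply Rdiv_le_0_compat; [| pos].
    apply Rmult_le_pos; [left; pos | apply pow2_ge_0].
  - unfold S, r, semiperimeter_ratio_sqr, inradius_ratio.
    field; repeat split; lra. }
assert (t3 : 0 <= 2 * t ^ 3)
  by (apply Rmult_le_pos; [lra | now apply pow_le]).
exists (sqrt (circumradius_sqr x y z)), t, S; repeat split; try assumption.
- now apply sqrt_lt_R0.
- assert (-(2 * t ^ 3) <= S - 2 - 10 * r + r ^ 2) by nra.
  rewrite <- er in *; nra.
- assert (S - 2 - 10 * r + r ^ 2 <= 2 * t ^ 3) by nra.
  rewrite <- er in *; nra.
- intros n hn.
  rewrite center_dist5_sqr, er, pow2_sqrt;
    [rewrite ea, eb, ec; now apply nine_point_sqr_ravi | lra | assumption |].
  rewrite ea, eb, ec; now apply weight_sum_neq0.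
Qed.

(** * Bounds in [t] for the individual centers *)

Lemma le_of_sqr (d rho F k : R) :
  0 < rho -> 0 <= k -> d ^ 2 = rho ^ 2 * F -> F <= k ^ 2 -> d <= rho * k.
Proof.
intros hr hk hd hF; apply Rsqr_incr_0_var; [| apply Rmult_le_pos; lra].
rewrite !Rsqr_pow2, hd, Rpow_mult_distr.
apply Rmult_le_compat_l; [apply pow2_ge_0 | assumption].
Qed.

Lemma ge_of_sqr (d rho F k : R) :
  0 < rho -> 0 <= d -> d ^ 2 = rho ^ 2 * F -> k ^ 2 <= F -> rho * k <= d.
Proof.
intros hr hd0 hd hF; apply Rsqr_incr_0_var; [| assumption].
rewrite !Rsqr_pow2, hd, Rpow_mult_distr.
apply Rmult_le_compat_l; [apply pow2_ge_0 | assumption].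
Qed.

Lemma eq_third_of_sqr (d e : R) :
  0 <= d -> 0 <= e -> d ^ 2 = e ^ 2 / 9 -> d = 1 / 3 * e.
Proof.
intros hd he h; apply Rsqr_inj; [assumption | lra |].
rewrite !Rsqr_pow2, h; field.
Qed.

(** The squared distance is affine and decreasing in [S]; the two squares are its values at the ends
    of the interval. *)
Lemma circumcenter_bounds (t S : R) :
  0 <= t < 1 ->
  (1 - t) * (3 + t) ^ 3 <= 4 * S <= (1 + t) * (3 - t) ^ 3 ->
  (t / 2 * (2 - t)) ^ 2 <= unit_dist_sqr 3 ((1 - t ^ 2) / 2) S
    <= (t / 2 * (2 + t)) ^ 2.
Proof. intros ht hS; cbn [unit_dist_sqr]; split; nra. Qed.

(** By the median formula the squared distances to X_3 and X_8 add up to [2 * t ^ 2 + t ^ 4 / 2], so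
    the circumcenter bounds reappear with the ends swapped. *)
Lemma nagel_bounds (t S : R) :
  0 <= t < 1 ->
  (1 - t) * (3 + t) ^ 3 <= 4 * S <= (1 + t) * (3 - t) ^ 3 ->
  (t / 2 * (2 - t)) ^ 2 <= unit_dist_sqr 8 ((1 - t ^ 2) / 2) S
    <= (t / 2 * (2 + t)) ^ 2.
Proof. intros ht hS; cbn [unit_dist_sqr]; split; nra. Qed.

Lemma mittenpunkt_bounds (t S : R) :
  0 <= t < 1 ->
  (1 - t) * (3 + t) ^ 3 <= 4 * S <= (1 + t) * (3 - t) ^ 3 ->
  (t / 2 * ((4 + t - t ^ 2) / (3 + t))) ^ 2
    <= unit_dist_sqr 9 ((1 - t ^ 2) / 2) S
    <= (t / 2 * ((4 - t - t ^ 2) / (3 - t))) ^ 2.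
Proof.
intros ht hS; cbn [unit_dist_sqr]; set (r := (1 - t ^ 2) / 2).
assert (hr : 0 < r) by (unfold r; nra).
(* The slope in [S] is [- kappa], so the lower bound comes from the largest [S]. *)
set (kappa := r * (r + 1) / (r + 4) ^ 2).
assert (hk : 0 < kappa) by (apply Rdiv_lt_0_compat; pos).
replace (r * (r + 1) * S / (r + 4) ^ 2) with (kappa * S)
  by (unfold kappa; field; lra).
split.
- replace ((_ * _) ^ 2)
    with (1 / 4 - kappa * ((1 + t) * (3 - t) ^ 3 / 4)); [nra |].
  unfold kappa, r; field; split; nra.
- replace ((_ * _) ^ 2)
    with (1 / 4 - kappa * ((1 - t) * (3 + t) ^ 3 / 4)); [nra |].
  unfold kappa, r; field; split; nra.
Qed.

(** The slope in [S] is positive, so only the upper end matters. There the value falls short of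
    [(t / 2) ^ 2], the squared distance to the Spieker center, by an explicit nonnegative
    fraction. *)
Lemma gergonne_bound (t S : R) :
  0 <= t < 1 -> 4 * S <= (1 + t) * (3 - t) ^ 3 ->
  unit_dist_sqr 7 ((1 - t ^ 2) / 2) S <= (t / 2) ^ 2.
Proof.
intros ht hS; cbn [unit_dist_sqr]; set (r := (1 - t ^ 2) / 2).
assert (hr : 0 < r < 4) by (unfold r; nra).
set (kappa := 3 * r * (4 - r) / (2 * (r + 4) ^ 2)).
assert (hk : 0 < kappa) by (apply Rdiv_lt_0_compat; pos).
replace (3 * r * (4 - r) * S / (2 * (r + 4) ^ 2)) with (kappa * S)
  by (unfold kappa; field; lra).
apply Rle_trans
  with (1 / 4 - r * (r + 4) / 2 + kappa * ((1 + t) * (3 - t) ^ 3 / 4));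
  [nra |].
replace (_ + _) with ((t / 2) ^ 2
  - (1 - t ^ 2) * (t ^ 2 * (1 - t) * (5 - t)) / (4 * (3 + t) ^ 2))
  by (unfold kappa, r; field; split; nra).
assert (0 <= (1 - t ^ 2) * (t ^ 2 * (1 - t) * (5 - t)) / (4 * (3 + t) ^ 2)).
{ apply Rdiv_le_0_compat; [| pos].
  repeat apply Rmult_le_pos; nra. }
lra.
Qed.

Lemma symmedian_bound (t S : R) :
  0 <= t < 1 ->
  (1 - t) * (3 + t) ^ 3 <= 4 * S <= (1 + t) * (3 - t) ^ 3 ->
  unit_dist_sqr 6 ((1 - t ^ 2) / 2) S <=
  (t / 2 * ((2 + 3 * t - 4 * t ^ 2 + t ^ 3) / (t ^ 2 - 2 * t + 3))) ^ 2.
Proof.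
intros ht hS; cbn [unit_dist_sqr]; set (r := (1 - t ^ 2) / 2).
assert (hr : 0 < r <= 1 / 2) by (unfold r; nra).
set (q := r * (r + 4)); set (D := S - q).
(* [D1] is [D] at the upper end of the interval. The squared distance is a quadratic in [/ D] that
   decreases for positive [/ D] because [q < 6]. *)
set (D1 := (1 + t) * (3 - t) * (t ^ 2 - 2 * t + 3) / 2).
assert (hD : 0 < D).
{ assert (0 < t ^ 2 + 2 * t + 3) by nra.
  assert (0 < (1 - t) * (3 + t) * (t ^ 2 + 2 * t + 3)) by pos.
  unfold D, q, r; lra. }
assert (hD1 : D <= D1) by (unfold D1, D, q, r; lra).
assert (hi : / D1 <= / D) by now apply Rinv_le_contravar.
assert (hi0 : 0 < / D1) by (apply Rinv_0_lt_compat; lra).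
assert (hq : 0 < q < 6) by (unfold q; nra).
apply Rle_trans with (1 / 4 + 2 * r ^ 2
  - r ^ 2 * ((12 - 2 * q) * / D1 + 12 * q * (/ D1) ^ 2)).
- replace S with (D + q) by (unfold D; ring).
  replace (_ + _) with (1 / 4 + 2 * r ^ 2
    - r ^ 2 * ((12 - 2 * q) * / D + 12 * q * (/ D) ^ 2))
    by (field; lra).
  apply Rplus_le_compat_l, Ropp_le_contravar, Rmult_le_compat_l;
    [apply pow2_ge_0 |].
  apply Rplus_le_compat; apply Rmult_le_compat_l; try lra.
  apply pow_incr; lra.
- apply Req_le; unfold D1, q, r; field; split; nra.
Qed.

(** * The extremal constants *)

Lemma poly4_bounds (C : R) :
  positive_root poly4 C -> 1.0533221345 <= C <= 1.0533221355.
Proof.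
intros hC; destruct poly4_root_exists as (x & hx & b).
now rewrite (poly4_root_unique _ _ hC hx).
Qed.

Lemma poly5_bounds (C : R) :
  positive_root poly5 C -> 1.1945050725 <= C <= 1.1945050735.
Proof.
intros hC; destruct poly5_root_exists as (x & hx & b).
now rewrite (poly5_root_unique _ _ hC hx).
Qed.

(* C5 is the value at which the cubic in t has a double root t0 in [0, 1];
   eliminating between the cubic and its derivative gives t0. *)
Lemma symmedian_spieker (C t : R) :
  positive_root poly5 C -> 0 <= t < 1 ->
  2 + 3 * t - 4 * t ^ 2 + t ^ 3 <= C * (t ^ 2 - 2 * t + 3).
Proof.
intros hC ht; pose proof (poly5_bounds C hC) as b; destruct hC as [_ hC].
set (q := C ^ 2 + 2 * C + 7); set (p := C ^ 2 - 8 * C + 15).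
assert (hq : 0 < q) by (unfold q; nra).
(* [e] is the third root, since the roots add up to [C + 4]. Below, [e1] is the vanishing derivative
   at [t0] and [e0] compares constant terms. *)
set (t0 := p / q); set (e := C + 4 - 2 * t0).
assert (he : 1 <= e).
{ assert (t0 <= 1) by (apply Rle_div_l; unfold p, q; nra).
  unfold e; lra. }
assert (e1 : 3 * t0 ^ 2 - 2 * (C + 4) * t0 + (2 * C + 3) = 0).
{ replace (_ + _) with (18 * poly5 C / q ^ 2)
    by (unfold t0, poly5, q, p; field; exact (Rgt_not_eq _ _ hq)).
  rewrite hC; lra. }
assert (e0 : t0 ^ 2 * e - (3 * C - 2) = 0).
{ replace (_ - _)
    with ((-2 * C ^ 3 - 24 * C ^ 2 + 66 * C - 236) * poly5 C / q ^ 3)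
    by (unfold e, t0, poly5, q, p; field; exact (Rgt_not_eq _ _ hq)).
  rewrite hC; lra. }
assert (E : C * (t ^ 2 - 2 * t + 3) - (2 + 3 * t - 4 * t ^ 2 + t ^ 3)
  = (t - t0) ^ 2 * (e - t)
    - t * (3 * t0 ^ 2 - 2 * (C + 4) * t0 + (2 * C + 3))
    - (t0 ^ 2 * e - (3 * C - 2))) by (unfold e; ring).
rewrite e1, e0 in E.
assert (0 <= (t - t0) ^ 2 * (e - t))
  by (apply Rmult_le_pos; [apply pow2_ge_0 | lra]).
lra.
Qed.

(* As for C5: t0 is the double root, expressed as a quotient of quadratics
   in C modulo poly4. *)
Lemma symmedian_mittenpunkt (C t : R) :
  positive_root poly4 C -> 0 <= t < 1 ->
  (2 + 3 * t - 4 * t ^ 2 + t ^ 3) * (3 + t)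
    <= C * ((t ^ 2 - 2 * t + 3) * (4 + t - t ^ 2)).
Proof.
intros hC ht; pose proof (poly4_bounds C hC) as b; destruct hC as [_ hC].
set (q := 50367 * C ^ 2 + 65356 * C + 39583).
set (p := 78266 * C ^ 2 - 23032 * C + 66996).
assert (hq : 0 < q) by (unfold q; nra).
set (t0 := p / q).
(* [beta] and [gamma] come from dividing the quartic by [(s - t0) ^ 2], matching the coefficients of
   [s ^ 3] and [s ^ 2]. The other two coefficients match by [e1] and [e0]. *)
set (beta := 3 * C + 1 - 2 * (C + 1) * t0).
set (gamma := 9 - C + 2 * t0 * beta + (C + 1) * t0 ^ 2).
assert (ht0 : 0 < t0 < 1).
{ split; [apply Rdiv_lt_0_compat; unfold p, q; nra |].
  apply Rlt_div_l; unfold p, q; nra. }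
assert (e1 : t0 ^ 2 * beta - 2 * t0 * gamma + (5 * C + 11) = 0).
{ replace (_ + _) with
    ((28827801067 * C ^ 2 - 259283512060 * C + 438708307147)
     * poly4 C / q ^ 3)
    by (unfold gamma, beta, t0, poly4, q, p; field;
        exact (Rgt_not_eq _ _ hq)).
  rewrite hC; lra. }
assert (e0 : t0 ^ 2 * gamma - (12 * C - 6) = 0).
{ replace (_ - _) with
    (- (9850227188050896 * C ^ 4 + 11841827355281718 * C ^ 3
        + 75058990180031022 * C ^ 2 + 12123348629683050 * C
        + 33787539715276518) * poly4 C / q ^ 4)
    by (unfold gamma, beta, t0, poly4, q, p; field;
        exact (Rgt_not_eq _ _ hq)).
  rewrite hC; lra. }
assert (E : forall s, C * ((s ^ 2 - 2 * s + 3) * (4 + s - s ^ 2))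
    - (2 + 3 * s - 4 * s ^ 2 + s ^ 3) * (3 + s)
  = (s - t0) ^ 2 * (gamma + beta * s - (C + 1) * s ^ 2)).
{ intros s.
  replace (_ - _) with
    ((s - t0) ^ 2 * (gamma + beta * s - (C + 1) * s ^ 2)
     - s * (t0 ^ 2 * beta - 2 * t0 * gamma + (5 * C + 11))
     - (t0 ^ 2 * gamma - (12 * C - 6))) by (unfold gamma, beta; ring).
  rewrite e1, e0; ring. }
(* The other factor is concave in s, so its sign is decided at 0 and 1. *)
assert (h0 : 0 < gamma).
{ apply (Rmult_lt_reg_l (t0 ^ 2)); [apply pow_lt |]; lra. }
(* The quartic takes the values [12 * C - 6] at 0 and [8 * (C - 1)] at 1, both positive since
   [C > 1]. *)
assert (h1 : 0 < gamma + beta - (C + 1)).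
{ apply (Rmult_lt_reg_l ((1 - t0) ^ 2)); [apply pow_lt; lra |].
  pose proof (E 1); lra. }
assert (hQ : 0 <= gamma + beta * t - (C + 1) * t ^ 2).
{ replace (_ - _) with ((1 - t) * gamma
    + (t * (gamma + beta - (C + 1)) + t * ((C + 1) * (1 - t)))) by ring.
  repeat apply Rplus_le_le_0_compat; repeat apply Rmult_le_pos; lra. }
pose proof (Rmult_le_pos _ _ (pow2_ge_0 (t - t0)) hQ) as hg.
rewrite <- E in hg; lra.
Qed.

(** The difference of the two sides is the square of [t - (3 - 2 * sqrt 2)]. *)
Lemma mittenpunkt_spieker (t : R) :
  4 - t - t ^ 2 <= (7 - 4 * sqrt 2) * (3 - t).
Proof.
assert (h : sqrt 2 ^ 2 = 2) by (apply pow2_sqrt; lra).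
pose proof (pow2_ge_0 (t - (3 - 2 * sqrt 2))); nra.
Qed.

(** * Comparison of the distances *)

Theorem theorem5 (C4 C5 : R)
  (hC4 : positive_root poly4 C4) (hC5 : positive_root poly5 C5)
  (A B C : point) (hABC : nondegenerate A B C) :
  center_dist A B C 5 1 <= 3 * center_dist A B C 5 2 /\
  center_dist A B C 5 1 <= center_dist A B C 5 3 /\
  center_dist A B C 5 1 <= center_dist A B C 5 4 /\
  center_dist A B C 5 1 <= center_dist A B C 5 8 /\
  center_dist A B C 5 1 <= center_dist A B C 5 9 /\
  center_dist A B C 5 1 <= center_dist A B C 5 10 /\
  center_dist A B C 5 2 = 1 / 3 * center_dist A B C 5 3 /\
  center_dist A B C 5 2 = 1 / 3 * center_dist A B C 5 4 /\
  1 / 3 * center_dist A B C 5 6 <= center_dist A B C 5 2 /\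
  1 / 3 * center_dist A B C 5 7 <= center_dist A B C 5 2 /\
  1 / 9 * center_dist A B C 5 8 <= center_dist A B C 5 2 <= center_dist A B C 5 8 /\
  1 / 3 * center_dist A B C 5 9 <= center_dist A B C 5 2 <= center_dist A B C 5 9 /\
  1 / 3 * center_dist A B C 5 10 <= center_dist A B C 5 2 <= center_dist A B C 5 10 /\
  center_dist A B C 5 3 = center_dist A B C 5 4 /\
  center_dist A B C 5 6 <= center_dist A B C 5 3 /\
  center_dist A B C 5 7 <= center_dist A B C 5 3 /\
  1 / 3 * center_dist A B C 5 8 <= center_dist A B C 5 3 <= 3 * center_dist A B C 5 8 /\
  center_dist A B C 5 9 <= center_dist A B C 5 3 <= 3 * center_dist A B C 5 9 /\
  center_dist A B C 5 10 <= center_dist A B C 5 3 <= 3 * center_dist A B C 5 10 /\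
  center_dist A B C 5 6 <= center_dist A B C 5 4 /\
  center_dist A B C 5 7 <= center_dist A B C 5 4 /\
  1 / 3 * center_dist A B C 5 8 <= center_dist A B C 5 4 <= 3 * center_dist A B C 5 8 /\
  center_dist A B C 5 9 <= center_dist A B C 5 4 <= 3 * center_dist A B C 5 9 /\
  center_dist A B C 5 10 <= center_dist A B C 5 4 <= 3 * center_dist A B C 5 10 /\
  center_dist A B C 5 6 <= center_dist A B C 5 8 /\
  center_dist A B C 5 6 <= C4 * center_dist A B C 5 9 /\
  center_dist A B C 5 6 <= C5 * center_dist A B C 5 10 /\
  center_dist A B C 5 7 <= center_dist A B C 5 8 /\
  center_dist A B C 5 7 <= center_dist A B C 5 9 /\
  center_dist A B C 5 7 <= center_dist A B C 5 10 /\
  center_dist A B C 5 9 <= center_dist A B C 5 8 <= 3 * center_dist A B C 5 9 /\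
  center_dist A B C 5 10 <= center_dist A B C 5 8 <= 3 * center_dist A B C 5 10 /\
  center_dist A B C 5 10 <= center_dist A B C 5 9 <= (7 - 4 * sqrt 2) * center_dist A B C 5 10.
Proof.
destruct (triangle_shape A B C hABC)
  as (rho & t & S & hrho & ht & hS & hd).
assert (d0 : forall n, 0 <= center_dist A B C 5 n)
  by (intros n; apply edist_nonneg).
pose proof (circumcenter_bounds t S ht hS) as [lo3 up3].
pose proof (nagel_bounds t S ht hS) as [lo8 up8].
pose proof (mittenpunkt_bounds t S ht hS) as [lo9 up9].
pose proof (gergonne_bound t S ht (proj2 hS)) as up7.
pose proof (symmedian_bound t S ht hS) as up6.
(* [mlo], [mup] and [k] bound the distances to X_9 and X_6 in units of [rho * (t / 2)], which is the
   distance to X_10. *)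
set (mlo := (4 + t - t ^ 2) / (3 + t)) in *.
set (mup := (4 - t - t ^ 2) / (3 - t)) in *.
set (k := (2 + 3 * t - 4 * t ^ 2 + t ^ 3) / (t ^ 2 - 2 * t + 3)) in *.
assert (hP : 0 < t ^ 2 - 2 * t + 3) by nra.
assert (bC4 := poly4_bounds C4 hC4).
assert (mlo1 : 1 <= mlo) by (apply Rle_div_r; nra).
assert (mup0 : 0 <= mup) by (apply Rdiv_le_0_compat; nra).
assert (k0 : 0 <= k) by (apply Rdiv_le_0_compat; nra).
assert (mup_le : mup <= 2 - t) by (apply Rle_div_l; nra).
assert (k_le : k <= 2 - t).
{ apply Rle_div_l; [lra |].
  (* This is half the difference of the two sides. *)
  assert (0 <= (1 - t) ^ 2 * (2 - t))
    by (apply Rmult_le_pos; [apply pow2_ge_0 | lra]); lra. }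
assert (k_C4 : k <= C4 * mlo).
{ apply Rle_div_l; [lra |].
  replace (C4 * mlo * (t ^ 2 - 2 * t + 3))
    with (C4 * ((t ^ 2 - 2 * t + 3) * (4 + t - t ^ 2)) / (3 + t))
    by (unfold mlo; field; lra).
  apply Rle_div_r; [lra |]; now apply symmedian_mittenpunkt. }
assert (k_C5 : k <= C5)
  by (apply Rle_div_l; [lra |]; now apply symmedian_spieker).
assert (mup_sqrt2 : mup <= 7 - 4 * sqrt 2)
  by (apply Rle_div_l; [lra |]; apply mittenpunkt_spieker).
assert (e2 : center_dist A B C 5 2 = 1 / 3 * center_dist A B C 5 3).
{ apply eq_third_of_sqr; try apply d0.
  rewrite !hd by lia; cbn [unit_dist_sqr]; field. }
assert (e4 : center_dist A B C 5 4 = center_dist A B C 5 3).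
{ apply Rsqr_inj; try apply d0.
  rewrite !Rsqr_pow2, !hd by lia; reflexivity. }
assert (t2 : 0 <= t / 2) by lra.
assert (D1 : center_dist A B C 5 1 <= rho * (t / 2 * t)).
{ apply (le_of_sqr _ _ _ _ hrho) with (2 := hd 1%nat ltac:(lia)); [nra |].
  cbn [unit_dist_sqr]; apply Req_le; field. }
assert (D3l : rho * (t / 2 * (2 - t)) <= center_dist A B C 5 3)
  by (apply (ge_of_sqr _ _ _ _ hrho (d0 _)) with (1 := hd 3%nat ltac:(lia));
      assumption).
assert (D3u : center_dist A B C 5 3 <= rho * (t / 2 * (2 + t)))
  by (apply (le_of_sqr _ _ _ _ hrho) with (2 := hd 3%nat ltac:(lia));
      [nra | assumption]).
assert (D6 : center_dist A B C 5 6 <= rho * (t / 2 * k))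
  by (apply (le_of_sqr _ _ _ _ hrho) with (2 := hd 6%nat ltac:(lia));
      [nra | assumption]).
assert (D7 : center_dist A B C 5 7 <= rho * (t / 2))
  by (apply (le_of_sqr _ _ _ _ hrho) with (2 := hd 7%nat ltac:(lia));
      assumption).
assert (D8l : rho * (t / 2 * (2 - t)) <= center_dist A B C 5 8)
  by (apply (ge_of_sqr _ _ _ _ hrho (d0 _)) with (1 := hd 8%nat ltac:(lia));
      assumption).
assert (D8u : center_dist A B C 5 8 <= rho * (t / 2 * (2 + t)))
  by (apply (le_of_sqr _ _ _ _ hrho) with (2 := hd 8%nat ltac:(lia));
      [nra | assumption]).
assert (D9l : rho * (t / 2 * mlo) <= center_dist A B C 5 9)
  by (apply (ge_of_sqr _ _ _ _ hrho (d0 _)) with (1 := hd 9%nat ltac:(lia));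
      assumption).
assert (D9u : center_dist A B C 5 9 <= rho * (t / 2 * mup))
  by (apply (le_of_sqr _ _ _ _ hrho) with (2 := hd 9%nat ltac:(lia));
      [nra | assumption]).
assert (D10 : center_dist A B C 5 10 = rho * (t / 2)).
{ apply Rle_antisym.
  - apply (le_of_sqr _ _ _ _ hrho) with (2 := hd 10%nat ltac:(lia));
      [assumption | cbn [unit_dist_sqr]; apply Req_le; field].
  - apply (ge_of_sqr _ _ _ _ hrho (d0 _)) with (1 := hd 10%nat ltac:(lia)).
    cbn [unit_dist_sqr]; apply Req_le; field. }
clear hd lo3 up3 lo8 up8 lo9 up9 up7 up6.
assert (T0 : 0 <= rho * (t / 2)) by nra.
rewrite <- (Rmult_assoc rho (t / 2)) in *.
set (T := rho * (t / 2)) in *.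
(* Scaling the comparisons of factors by [T] leaves claims linear in the distances and in products
   such as [T * k] and [T * mlo]. *)
assert (mono : forall u v, u <= v -> T * u <= T * v)
  by (intros; now apply Rmult_le_compat_l).
pose proof (mono t 1 ltac:(lra)).
pose proof (mono _ _ mlo1).
pose proof (mono _ _ mup_le).
pose proof (mono _ _ k_le).
pose proof (mono _ _ k_C4).
pose proof (mono _ _ k_C5).
pose proof (mono _ _ mup_sqrt2).
assert (C4 * (T * mlo) <= C4 * center_dist A B C 5 9)
  by (apply Rmult_le_compat_l; lra).
rewrite e2, e4, D10; repeat split; lra.
Qed.
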